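(* Let $M=(E,\rho)$ be a matroid of rank $d\ge 0$. Then $$\widehat{Y}_M(p,t)=\sum_{i=0}^{d-1}W_i^M(p)\,p^{d-1-i}\,t^i.$$
   Context: A matroid $M=(E,\rho)$ has finite ground set $E$, rank function $\rho$, rank $d(M)=\rho(E)$, and corank function $\sigma(S)=\#S-\rho(S)$. The Tutte polynomial is $T_M(x,y)=\sum_{S\subseteq E}(x-1)^{\rho(E)-\rho(S)}(y-1)^{\sigma(S)}$. Define $Y_M(q,t):=(1-q)^{\rho(E)}q^{\sigma(E)}T_M\!\left(\frac{qt+1-q}{1-q},\frac1q\right)$ and $\widehat{Y}_M(p,t):=\frac{(-1)^{d(M)}Y_M(1+p,-t)-t^{d(M)}}{1+t}$. For $d\ge1$ and $0\le i\le d-1$, let $\mathcal{S}_i^M=\{S\subseteq E:\rho(S)\ge d-i\}$ ordered by inclusion, $\mathcal{L}_i^M=\{\hat0\}\oplus\mathcal{S}_i^M$ (new minimum adjoined), $\mu_i^M(S)$ the Möbius function $\mu(\hat0,S)$ of $\mathcal{L}_i^M$, and $$W_i^M(p):=\sum_{S\in\mathcal{S}_i^M}\mu_i^M(S)(-p)^{\#S-d+1+i}.$$ (When $d=0$ the sum in the claim is empty.) *)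

(* Defs.v *)
From HB Require Import structures.
From mathcomp Require Import all_boot all_order all_algebra.

Set Implicit Arguments.
Unset Strict Implicit.
Unset Printing Implicit Defensive.

Import Order.TTheory GRing.Theory Num.Theory.
Local Open Scope ring_scope.

Section Moebius.
Context {d : Order.disp_t} {P : finPOrderType d}.
Implicit Types x y z : P.

(* The first argument is recursion fuel; each unfolding strictly decreases y,
   so #|P| steps always suffice (lemma [moebius_lt] below). *)
Fixpoint moebius_rec (n : nat) x y : int :=
  if n is n'.+1 then
    if x == y then 1
    else if (x < y)%O then
      - \sum_(z : P | (x <= z)%O && (z < y)%O) moebius_rec n' x z
    else 0
  else 0.

Definition moebius x y : int := moebius_rec #|P| x y.

Let below y := #|[pred z : P | (z <= y)%O]|.

Let below_lt y z : (z < y)%O -> (below z < below y)%N.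
Proof.
move=> ltzy; apply/proper_card/properP; split.
  by apply/subsetP => u; rewrite !inE => /le_trans; apply; apply: ltW.
by exists y; rewrite !inE ?lexx // lt_geF.
Qed.

Let moebius_rec_fuel n m x y :
  (below y <= n)%N -> (below y <= m)%N ->
  moebius_rec n x y = moebius_rec m x y.
Proof.
have below_gt0 u : (0 < below u)%N.
  by apply/card_gt0P; exists u; rewrite inE lexx.
elim: n m y => [|n IHn] [|m] y; rewrite ?leqn0 ?(gtn_eqF (below_gt0 y)) //=.
move=> len lem; case: eqP => // _; case: ifP => // _; congr (- _).
apply: eq_bigr => z /andP[_ ltzy].
by apply: IHn; rewrite -ltnS; apply: leq_trans (below_lt ltzy) _.
Qed.

Lemma moebiusxx x : moebius x x = 1.
Proof.
rewrite /moebius; have : (0 < #|P|)%N by apply/card_gt0P; exists x.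
by case: #|P| => //= n _; rewrite eqxx.
Qed.

Lemma moebius_lt x y : (x < y)%O ->
  moebius x y = - \sum_(z : P | (x <= z)%O && (z < y)%O) moebius x z.
Proof.
move=> ltxy; have leP u : (below u <= #|P|)%N by apply: max_card.
rewrite /moebius (moebius_rec_fuel x (leP y) (leqW (leP y))) /=.
by rewrite lt_eqF // ltxy.
Qed.

Lemma moebius_nle x y : ~~ (x <= y)%O -> moebius x y = 0.
Proof.
rewrite /moebius le_eqVlt negb_or; case: #|P| => //= n.
by case/andP=> /negbTE-> /negbTE->.
Qed.

End Moebius.

(* The ordinal sum {0} (+) P: [None] is the new minimum. *)
Definition adjoin_min {d : Order.disp_t} (P : finPOrderType d) : Type :=
  option P.

Section AdjoinMin.
Context {d : Order.disp_t} {P : finPOrderType d}.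

HB.instance Definition _ := Finite.copy (adjoin_min P) (option P).

Definition adjoin_min_le (x y : adjoin_min P) : bool :=
  match x, y with
  | None, _ => true
  | Some _, None => false
  | Some a, Some b => (a <= b)%O
  end.

Fact adjoin_min_le_refl : reflexive adjoin_min_le.
Proof. by case=> //= a. Qed.

Fact adjoin_min_le_anti : antisymmetric adjoin_min_le.
Proof. by move=> [a|] [b|] //= /le_anti->. Qed.

Fact adjoin_min_le_trans : transitive adjoin_min_le.
Proof. by move=> [b|] [a|] [c|] //=; apply: le_trans. Qed.

HB.instance Definition _ := Order.Le_isPOrder.Build d (adjoin_min P)
  adjoin_min_le_refl adjoin_min_le_anti adjoin_min_le_trans.

Fact adjoin_min_le0 (x : adjoin_min P) : (None <= x :> adjoin_min P)%O.
Proof. by []. Qed.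

HB.instance Definition _ :=
  Order.hasBottom.Build d (adjoin_min P) adjoin_min_le0.

End AdjoinMin.

Record matroid (E : finType) := Matroid {
  rk :> {set E} -> nat;
  rk_le_card : forall A : {set E}, (rk A <= #|A|)%N;
  rk_mono : forall A B : {set E}, A \subset B -> (rk A <= rk B)%N;
  rk_submod : forall A B : {set E}, (rk (A :|: B) + rk (A :&: B) <= rk A + rk B)%N
}.

(* The natural-number subtractions in [cork], [tutte] and [W] never truncate:
   rk S <= #|S|, rk S <= d(M), and d(M) - i <= rk S <= #|S| on [high_rank]. *)
Section MatroidPolynomials.
Context {E : finType} (M : matroid E).

Definition matroid_rank : nat := M [set: E].

Definition cork (S : {set E}) : nat := #|S| - M S.

(* x is the outer variable 'X and y the inner variable 'Y, so that T(x, y) is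
   [tutte.[x, y]]. *)
Definition tutte (R : comNzRingType) : {poly {poly R}} :=
  \sum_(S : {set E})
    ('X - 1) ^+ (M [set: E] - M S) * ('Y - 1) ^+ cork S.

Definition Y (K : fieldType) (q t : K) : K :=
  (1 - q) ^+ M [set: E] * q ^+ cork [set: E]
    * (tutte K).[(q * t + 1 - q) / (1 - q), 1 / q].

Definition Yhat (K : fieldType) (p t : K) : K :=
  ((-1) ^+ matroid_rank * Y (1 + p) (- t) - t ^+ matroid_rank) / (1 + t).

Definition high_rank (i : nat) : Type :=
  {S : {set E} | (matroid_rank - i <= M S)%N}.

Section HighRankOrder.
Variable i : nat.

HB.instance Definition _ := SubFinite.on (high_rank i).

Definition high_rank_le (S T : high_rank i) : bool := val S \subset val T.

Fact high_rank_le_refl : reflexive high_rank_le.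
Proof. by move=> S; apply: subxx. Qed.

Fact high_rank_le_anti : antisymmetric high_rank_le.
Proof. by move=> S T leST; apply/val_inj/eqP; rewrite eqEsubset. Qed.

Fact high_rank_le_trans : transitive high_rank_le.
Proof. by move=> T S U; apply: subset_trans. Qed.

HB.instance Definition _ := Order.Le_isPOrder.Build
  Order.SetSubsetOrder.subset_display (high_rank i)
  high_rank_le_refl high_rank_le_anti high_rank_le_trans.

End HighRankOrder.

Definition W (R : comNzRingType) (i : nat) : {poly R} :=
  \sum_(S : high_rank i)
    (moebius (\bot%O : adjoin_min (high_rank i)) (Some S))%:~R
      * (- 'X) ^+ (#|val S| + 1 + i - matroid_rank).

End MatroidPolynomials.

(* Main.v *)
Require Import Defs.
From HB Require Import structures.
From mathcomp Require Import all_boot all_order all_algebra.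
From mathcomp Require Import ring zify.

Import Order.TTheory GRing.Theory Num.Theory.
Local Open Scope ring_scope.

(* Substituting into the Tutte polynomial gives
     (-1)^d Y(1+p, -t) = \sum_S (-1)^rk(S) w(S) t^(d - rk S),
   where w(S) = (-p)^#S (1+p)^(#E - #S) is a signed binomial weight with
     \sum_(S >= A) w(S) = (-p)^#A.
   Since the Moebius values mu_i(A) over A <= S in S_i sum to -1 and S_i is an
   up-set, exchanging sums gives \sum_A mu_i(A) (-p)^#A = - \sum_(S in S_i) w(S),
   i.e. W_i(p) p^(d-1-i) = (-1)^(d-i) \sum_(S in S_i) w(S). Multiplying by t^i,
   summing over i and exchanging with S leaves a geometric sum in -t, from d - rk S to
   d - 1, which 1 + t telescopes. *)

Section BinomialWeight.
Context {E : finType} {R : comNzRingType}.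

(** Formally, the probability that a random subset, containing each element independently with
    probability [u], equals [S]. *)
Definition binomial_weight (u : R) (S : {set E}) : R :=
  u ^+ #|S| * (1 - u) ^+ #|~: S|.

(** Expand a product with one binomial factor per element: the zero summand at elements of [A] kills
    every [S] missing one of them. *)
Lemma sum_binomial_weight_supset (u : R) (A : {set E}) :
  \sum_(S : {set E} | A \subset S) binomial_weight u S = u ^+ #|A|.
Proof.
transitivity (\prod_(i : E) (u + (if i \in A then 0 else 1 - u))); last first.
  rewrite (bigID (mem A)) /= [X in _ * X]big1 ?mulr1 => [|i /negbTE->]; last by ring.
  rewrite (eq_bigr (fun=> u)) => [|i ->]; last by rewrite addr0.
  by rewrite prodr_const.
rewrite bigA_distr /= [RHS](bigID (fun S : {set E} => A \subset S)) /=.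
rewrite [X in _ = _ + X]big1 ?addr0 => [|S /subsetPn[i iA iS]]; last first.
  by rewrite (bigD1 i) //= (negbTE iS) iA mul0r.
apply: eq_big => // S sAS; rewrite (bigID (mem S)) /=; congr (_ * _).
  by rewrite (eq_bigr (fun=> u)) ?prodr_const // => i ->.
rewrite (eq_bigr (fun=> 1 - u)) => [|i niS].
  by rewrite prodr_const; congr (_ ^+ _); apply: eq_card => i; rewrite !inE.
by rewrite (negbTE niS); case: ifP niS => // /(subsetP sAS) ->.
Qed.

Lemma sum_binomial_weight (u : R) : \sum_(S : {set E}) binomial_weight u S = 1.
Proof.
rewrite -[RHS](expr0 u) -(cards0 E) -sum_binomial_weight_supset.
by apply: eq_bigl => S; rewrite sub0set.
Qed.

End BinomialWeight.

(** Moebius values over the whole interval from the bottom to [y] sum to 0, and the adjoined bottom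
    accounts for 1. *)
Lemma sum_moebius_adjoin_min {disp : Order.disp_t} {P : finPOrderType disp} (y : P) :
  \sum_(z : P | (z <= y)%O) moebius (\bot%O : adjoin_min P) (Some z) = -1.
Proof.
have /moebius_lt moebius_y : ((\bot%O : adjoin_min P) < Some y)%O by [].
rewrite (bigD1 y) //= moebius_y (bigD1 (None : adjoin_min P)) //= moebiusxx.
rewrite (reindex_omap Some id) /= => [|[]//].
rewrite (eq_bigl (fun z => (z <= y)%O && (z != y))) => [|z]; first by ring.
by rewrite andbT eqxx andbT lt_neqAle andbC.
Qed.

Lemma sum_alternating_powers {R : comNzRingType} (t : R) {k d : nat} : (k <= d)%N ->
  (1 + t) * \sum_(i < d | (k <= i)%N) (-1) ^+ (d - i) * t ^+ i =
  (-1) ^+ (d - k) * t ^+ k - t ^+ d.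
Proof.
elim: d => [|d IHd]; first by rewrite leqn0 => /eqP ->; rewrite big_ord0; ring.
rewrite leq_eqVlt => /orP[/eqP -> | ltkd].
  rewrite big_pred0 ?subnn; first by ring.
  by move=> i; rewrite leqNgt ltn_ord.
rewrite big_mkcond big_ord_recr /= -ltnS ltkd subSnn -big_mkcond /=.
(* Raising [d] by one flips the sign of every old term. *)
rewrite (eq_bigr (fun i : 'I_d => - ((-1) ^+ (d - i) * t ^+ i))) => [|i _]; last first.
  by rewrite subSn 1?ltnW // exprS mulN1r mulNr.
rewrite sumrN mulrDr mulrN IHd // subSn // !exprS; ring.
Qed.

Section MatroidPolynomials.
Context {E : finType} (M : matroid E) {K : fieldType}.
Implicit Types S : {set E}.

Local Notation d := (matroid_rank M).

Lemma rk_le_rank S : (M S <= d)%N.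
Proof. exact: rk_mono (subsetT S). Qed.

(** Here [x - 1 = q * t / (1 - q)] and [y - 1 = (1 - q) / q]; collecting exponents leaves [#|S|] on
    [1 - q] and [#|~: S|] on [q]. *)
Lemma Y_rank_sum (q t : K) : q != 0 -> 1 - q != 0 ->
  Y M q t = \sum_(S : {set E}) binomial_weight (1 - q) S * t ^+ (d - M S).
Proof.
move=> q0 q1; rewrite /Y /tutte horner_sum horner_sum mulr_sumr.
apply: eq_bigr => S _; rewrite !hornerE /=.
have -> : (q * t + 1 - q) / (1 - q) - 1 = q * t / (1 - q) by field.
have -> : q^-1 - 1 = (1 - q) / q by field.
have := cardsC S; have := rk_le_card M S; have := rk_le_rank S.
have := rk_le_card M [set: E]; rewrite /binomial_weight /cork /matroid_rank cardsT.
move=> leE ler leS cardE.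
have -> : (#|E| - M [set: E] = #|E| - M S - (M [set: E] - M S))%N by lia.
have -> : #|S| = (M S + (#|S| - M S))%N by lia.
have -> : (#|E| - M S = #|~: S| + (#|S| - M S))%N by lia.
have cE : (M [set: E] - M S <= #|~: S| + (#|S| - M S))%N by lia.
have -> : q ^+ (#|~: S| + (#|S| - M S) - (M [set: E] - M S)) =
    q ^+ #|~: S| * q ^+ (#|S| - M S) / q ^+ (M [set: E] - M S).
  by apply: (canRL (mulfK _)); rewrite ?expf_neq0 // -!exprD subnK.
rewrite -[in (1 - q) ^+ M [set: E]](subnKC ler) addKn subKr !exprD.
rewrite !expr_div_n !exprMn; field.
by rewrite !expf_neq0.
Qed.

Lemma W_rank_sum (p : K) (i : nat) : (i < d)%N ->
  (W M K i).[p] * p ^+ (d - 1 - i) =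
  (-1) ^+ (d - i) * \sum_(S : {set E} | (d - i <= M S)%N) binomial_weight (- p) S.
Proof.
move=> ltid.
transitivity ((-1) ^+ (d - i - 1) * \sum_(S : high_rank M i)
    (moebius (\bot%O : adjoin_min (high_rank M i)) (Some S))%:~R * (- p) ^+ #|val S|).
  rewrite /W horner_sum mulr_suml mulr_sumr; apply: eq_bigr => S _.
  have leS := leq_trans (valP S) (rk_le_card M (val S)).
  rewrite -(rmorph_int polyC) !hornerE /=.
  (* The factor [p ^+ (d - 1 - i)] restores the exponent of [- p] to [#|val S|], at the cost of a
     sign. *)
  have -> : (#|val S| + 1 + i - d = #|val S| - (d - i - 1))%N by lia.
  rewrite -[in RHS](@subnK (d - i - 1) #|val S|) ?exprD; last by lia.
  have -> : p ^+ (d - 1 - i) = (-1) ^+ (d - i - 1) * (- p) ^+ (d - i - 1).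
    by rewrite -exprMn mulN1r opprK subnAC.
  by ring.
under eq_bigr => S do rewrite -sum_binomial_weight_supset mulr_sumr.
rewrite (exchange_big_dep (fun S : {set E} => (d - i <= M S)%N)) /=; last first.
  (* Supersets of sets of high rank have high rank, so the outer sum stays inside the up-set. *)
  by move=> A S _ /(rk_mono M); apply: leq_trans (valP A).
rewrite (eq_bigr (fun S => - binomial_weight (- p) S)) => [|S dS].
  rewrite sumrN mulrN -mulNr; congr (_ * _).
  by rewrite -[in RHS](@subnK 1 (d - i)) ?subn_gt0 // exprD mulrN1.
rewrite -mulr_suml.
have := sum_moebius_adjoin_min (exist _ S dS : high_rank M i).
move/(congr1 (fun z : int => z%:~R : K)); rewrite rmorph_sum /= => ->.
by rewrite mulN1r.
Qed.

(** The hypotheses make the denominators [1 - q] and [q] of [Y] at [q = 1 + p], and [1 + t] of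
    [Yhat], invertible. *)
Lemma Yhat_W_sum (p t : K) : p != 0 -> 1 + p != 0 -> 1 + t != 0 ->
  Yhat M p t = \sum_(i < d) (W M K i).[p] * p ^+ (d - 1 - i) * t ^+ i.
Proof.
move=> p0 p1 t1; apply: (canLR (mulfK t1)).
have sub_p : 1 - (1 + p) = - p by ring.
rewrite Y_rank_sum ?sub_p ?oppr_eq0 // mulr_sumr.
under [in RHS]eq_bigr => i _ do
  rewrite W_rank_sum // mulrAC [X in _ * X]big_mkcond mulr_sumr.
rewrite exchange_big mulrC mulr_sumr /=.
(* The weights sum to 1, so [t ^+ d] can be spread over all [S] and the identity checked for each
   [S] separately. *)
have -> : t ^+ d = \sum_(S : {set E}) t ^+ d * binomial_weight (- p) S.
  by rewrite -mulr_sumr sum_binomial_weight mulr1.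
rewrite -sumrB.
apply: eq_bigr => S _.
transitivity (binomial_weight (- p) S *
    ((1 + t) * \sum_(i < d | (d - M S <= i)%N) (-1) ^+ (d - i) * t ^+ i)).
  rewrite sum_alternating_powers ?leq_subr // subKn ?rk_le_rank //.
  have sgn : (-1) ^+ d * (-1) ^+ (d - M S) = (-1) ^+ M S :> K.
    rewrite -[in (-1) ^+ d](subnKC (rk_le_rank S)) exprD -mulrA -expr2 sqrr_sign.
    by rewrite mulr1.
  by rewrite (exprNn t) -sgn; ring.
rewrite mulrCA; congr (_ * _); rewrite big_mkcond mulr_sumr; apply: eq_bigr => i _.
by rewrite leq_subCl; case: ifP => _; ring.
Qed.

End MatroidPolynomials.

(* p and t are the two indeterminates of the rational function field Q(p, t),
   presented as the fraction field of Z[p][t]. *)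
Theorem theorem2p6 (E : finType) (M : matroid E) :
  let K : fieldType := {fraction {poly {poly int}}} in
  let p : K := tofrac 'Y in
  let t : K := tofrac 'X in
  Yhat M p t =
    \sum_(i < matroid_rank M)
      (W M K i).[p] * p ^+ (matroid_rank M - 1 - i) * t ^+ i.
Proof.
move=> K p t; apply: Yhat_W_sum.
- by rewrite tofrac_eq0 polyC_eq0 polyX_eq0.
- rewrite -tofrac1 -tofracD tofrac_eq0 -polyC1 -polyCD polyC_eq0 addrC.
  by rewrite -size_poly_eq0 size_XaddC.
- rewrite -tofrac1 -tofracD tofrac_eq0 -polyC1 addrC.
  by rewrite -size_poly_eq0 size_XaddC.
Qed.
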